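(* Let $P$ and $Q$ be compact and connected topological spaces, and let $\kappa\colon P\to P$, $\lambda\colon Q\to Q$, $r\colon P\to Q$ and $s\colon Q\to P$ be continuous maps such that $r\kappa\simeq\lambda r$ and $s\lambda\simeq\kappa s$. Suppose that there are homotopies $G\colon P\times[0,1]\to\operatorname{T}(\kappa)$ from $j_\kappa sr$ to $j_\kappa sr\kappa$ and $G'\colon Q\times[0,1]\to\operatorname{T}(\lambda)$ from $j_\lambda rs$ to $j_\lambda rs\lambda$ such that the induced maps satisfy $(sr,G)_\#\simeq\operatorname{id}_{\operatorname{T}(\kappa)}$ and $(rs,G')_\#\simeq\operatorname{id}_{\operatorname{T}(\lambda)}$. Then $[\kappa]$ and $[\lambda]$ are shift equivalent.
   Context: The mapping torus of a continuous map $\kappa\colon P\to P$ is $\operatorname{T}(\kappa):=(P\times[0,1])/\big((x,1)\sim(\kappa(x),0)\big)$, and $j_\kappa\colon P\to\operatorname{T}(\kappa)$ is $j_\kappa(x)=[x,0]$. Induced maps: let $\alpha\colon P\to P$ be continuous with $\alpha\kappa\simeq\kappa\alpha$ and let $G\colon P\times[0,1]\to\operatorname{T}(\kappa)$ be a homotopy with $G(\cdot,0)=j_\kappa\alpha$ and $G(\cdot,1)=j_\kappa\alpha\kappa$ (such a homotopy exists since $j_\kappa\alpha\kappa\simeq j_\kappa\kappa\alpha\simeq j_\kappa\alpha$). Then $(\alpha,G)_\#\colon\operatorname{T}(\kappa)\to\operatorname{T}(\kappa)$ is the well-defined continuous map $(\alpha,G)_\#[x,\theta]=G(x,\theta)$.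 Homotopy classes $[\kappa\colon P\to P]$ and $[\lambda\colon Q\to Q]$ are called shift equivalent if there are continuous maps $r'\colon P\to Q$ and $s'\colon Q\to P$ such that $\lambda r'\simeq r'\kappa$, $s'\lambda\simeq\kappa s'$, $s'r'\simeq\kappa^n$ and $r's'\simeq\lambda^n$ for some $n\in\mathbb{N}$ (with $0\in\mathbb{N}$). Homotopies are unpointed. *)

(* Defs.v *)
From HB Require Import structures.
From Stdlib Require Import Relations.
From mathcomp Require Import all_boot all_order all_algebra generic_quotient.
From mathcomp Require Import all_classical reals topology.

Set Implicit Arguments.
Unset Strict Implicit.
Unset Printing Implicit Defensive.

Import Order.TTheory GRing.Theory Num.Theory.
Import numFieldTopology.Exports.
Local Open Scope classical_set_scope.
Local Open Scope ring_scope.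
Local Open Scope quotient_scope.

Section unit_interval.
Variable R : realType.

(* A [set_type], hence a type with the subspace topology inherited from [R]. *)
Definition unit_interval : Type := set_type [set` `[0 : R, 1]].
HB.instance Definition _ :=
  Topological.copy unit_interval (set_type [set` `[0 : R, 1]]).

Lemma zeroI_subproof : (0 : R) \in [set` `[0 : R, 1]].
Proof. by rewrite inE /= in_itv /= lexx ler01. Qed.

Lemma oneI_subproof : (1 : R) \in [set` `[0 : R, 1]].
Proof. by rewrite inE /= in_itv /= lexx ler01. Qed.

Definition zeroI : unit_interval := SigSub zeroI_subproof.
Definition oneI : unit_interval := SigSub oneI_subproof.

End unit_interval.

Arguments zeroI {R}.
Arguments oneI {R}.

Section homotopy.
Variables (R : realType) (X Y : topologicalType).

Definition is_homotopy (f g : X -> Y) (H : X * unit_interval R -> Y) : Prop :=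
  [/\ continuous H, forall x, H (x, zeroI) = f x & forall x, H (x, oneI) = g x].

Definition homotopic (f g : X -> Y) : Prop := exists H, is_homotopy f g H.

End homotopy.

Section mapping_torus.
Variables (R : realType) (P : topologicalType) (kappa : P -> P).

Variant torus_glue : relation (P * unit_interval R) :=
  TorusGlue x : torus_glue (x, oneI) (kappa x, zeroI).

Definition torus_rel (a b : P * unit_interval R) : bool :=
  `[< clos_refl_sym_trans _ torus_glue a b >].

Lemma torus_rel_refl : reflexive torus_rel.
Proof. by move=> a; apply/asboolP; exact: rst_refl. Qed.

Lemma torus_rel_sym : symmetric torus_rel.
Proof. by move=> a b; apply/asboolP/asboolP; exact: rst_sym. Qed.

Lemma torus_rel_trans : transitive torus_rel.
Proof.
by move=> b a c /asboolP ab /asboolP bc; apply/asboolP; exact: rst_trans bc.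
Qed.

Definition torus_equiv : equiv_rel (P * unit_interval R) :=
  EquivRel torus_rel torus_rel_refl torus_rel_sym torus_rel_trans.

Definition mapping_torus : Type := quotient_topology {eq_quot torus_equiv}.
HB.instance Definition _ :=
  Topological.copy mapping_torus (quotient_topology {eq_quot torus_equiv}).
HB.instance Definition _ :=
  Quotient.copy mapping_torus (quotient_topology {eq_quot torus_equiv}).

Definition torus_pi : P * unit_interval R -> mapping_torus := \pi.

Definition torus_j (x : P) : mapping_torus := torus_pi (x, zeroI).

(* [G] evaluated at a chosen representative of each class; it does not depend
   on that choice as soon as [G] has the right ends ([torus_inducedE]). *)
Definition torus_induced (G : P * unit_interval R -> mapping_torus)
  (z : mapping_torus) : mapping_torus := G (repr z).

End mapping_torus.

Section torus_induced_theory.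
Variables (R : realType) (P : topologicalType) (kappa alpha : P -> P).
Variable G : P * unit_interval R -> mapping_torus R kappa.
Hypothesis hG : is_homotopy (torus_j R kappa \o alpha)
                            (torus_j R kappa \o alpha \o kappa) G.

Lemma torus_induced_compat a b : torus_pi kappa a = torus_pi kappa b ->
  G a = G b.
Proof.
move=> /eqquotP /asboolP.
elim=> [_ _ [x]|//|c d _ -> //|c d e _ -> _ -> //].
by case: hG => _ -> ->.
Qed.

Lemma torus_inducedE x t :
  torus_induced G (torus_pi kappa (x, t)) = G (x, t).
Proof. by apply: torus_induced_compat; rewrite /torus_pi reprK. Qed.

Lemma torus_induced_continuous : continuous (torus_induced G).
Proof.
apply: (@repr_comp_continuous _ {eq_quot (torus_equiv R kappa)}).
  by case: hG.
by move=> a b /eqP ab; apply/eqP; exact: torus_induced_compat.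
Qed.

End torus_induced_theory.

Section shift_equivalence.
Variables (R : realType) (P Q : topologicalType).

Definition shift_equivalent (kappa : P -> P) (lambda : Q -> Q) : Prop :=
  exists (r : P -> Q) (s : Q -> P) (n : nat),
    [/\ continuous r, continuous s,
        homotopic R (lambda \o r) (r \o kappa) &
        homotopic R (s \o lambda) (kappa \o s)] /\
    homotopic R (s \o r) (iter n kappa) /\
    homotopic R (r \o s) (iter n lambda).

End shift_equivalence.

(* Main.v *)
Require Import Defs.
From mathcomp Require Import all_boot all_order all_algebra generic_quotient.
From mathcomp Require Import all_classical reals topology normedtype.
From mathcomp Require Import lra zify.

(* Restricting [(sr, G)_# ~ id] along [j] gives a homotopy [H] from [j sr] to
   [j] in the mapping torus. The circle coordinate of [H] lifts to a real valued
   [tau] with [tau = 0] at time 0; it is bounded since [P] is compact, and at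
   time 1 it is a constant integer [m] since [P] is connected. Writing [y(z)]
   for the first component of the representative [(y, theta)] of [z] with
   [theta < 1], the map [kappa^(N - floor tau) (y o H)] is continuous for large
   [N]: when [tau] crosses an integer upwards, [y] jumps by [kappa] and the
   exponent decreases by one. Hence [kappa^N sr ~ kappa^(N - m)], and similarly
   [lambda^N rs ~ lambda^(N - m')]. The two shifts [m] and [m'] need not be
   compared directly: moving [r] and [s] past the iterates shows that
   [lambda^(N - m)] and [lambda^(N - m')] become homotopic for large [N]. *)

Set Implicit Arguments.
Unset Strict Implicit.
Unset Printing Implicit Defensive.
Import Order.TTheory GRing.Theory Num.Theory.
Import numFieldNormedType.Exports.
Local Open Scope classical_set_scope.
Local Open Scope ring_scope.

(** * Clamping real times to the unit interval, and continuity at a point *)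

Section clamp.
Variable R : realType.

Lemma clamp_subproof (t : R) :
  Num.max 0 (Num.min t 1) \in [set` `[0 : R, 1]].
Proof.
by rewrite inE /= in_itv /= le_max lexx ge_max ler01 ge_min lexx orbT.
Qed.

Definition clamp (t : R) : unit_interval R := SigSub (clamp_subproof t).

Lemma val_unit_interval_continuous : continuous (val : unit_interval R -> R).
Proof. exact: initial_continuous. Qed.

Lemma unit_interval_itv (u : unit_interval R) : 0 <= val u <= 1.
Proof. by case: u => u /=; rewrite inE /= in_itv. Qed.

Lemma clamp_le0 t : t <= 0 -> clamp t = zeroI.
Proof.
by move=> t0; apply: val_inj => /=; rewrite (max_idPl _) // ge_min t0.
Qed.

Lemma clamp_ge1 t : 1 <= t -> clamp t = oneI.
Proof.
by move=> t1; apply: val_inj => /=; rewrite (min_idPr t1) (max_idPr _).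
Qed.

Lemma clamp_continuous : continuous clamp.
Proof.
apply: continuous_comp_initial => t.
have : {for t, continuous (fun u : R => Num.max 0 (Num.min u 1) : R^o)}.
  apply: (@continuous_max _ _ (fun=> 0 : R^o)); first exact: cvg_cst.
  by apply: (@continuous_min _ _ id); [exact: cvg_id | exact: cvg_cst].
by [].
Qed.

End clamp.

Lemma near_eq_continuous_at (X Y : topologicalType) (f g : X -> Y) x :
  (\forall y \near x, f y = g y) -> {for x, continuous f} ->
  {for x, continuous g}.
Proof.
move=> fg; rewrite /prop_for /continuous_at -(nbhs_singleton fg) => cf.
apply: cvg_trans cf; exact: near_eq_cvg.
Qed.

(** Near [x] both branches land in any prescribed neighbourhood of the common value, so it does not
    matter how [b] switches between them. *)
Lemma if_continuous_at (X Y : topologicalType) (b : X -> bool) (f g : X -> Y)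
    x :
  {for x, continuous f} -> {for x, continuous g} -> f x = g x ->
  {for x, continuous (fun y => if b y then f y else g y)}.
Proof.
move=> cf cg fg A.
have -> : (if b x then f x else g x) = f x by case: (b x).
move=> Af; have Ag : nbhs (g x) A by rewrite -fg.
have := cf _ Af; have := cg _ Ag; rewrite !nbhs_simpl /=.
by apply: filterS2 => y /= gy fy; rewrite /=; case: (b y).
Qed.

(** * Calculus of homotopies *)

Section homotopic_theory.
Variable R : realType.
Implicit Types X Y Z : topologicalType.

Lemma continuous_pair X Y Z (f : X -> Y) (g : X -> Z) x :
  {for x, continuous f} -> {for x, continuous g} ->
  {for x, continuous (fun y => (f y, g y))}.
Proof. by move=> cf cg; apply: cvg_pair. Qed.

Lemma fst_continuous X Y : continuous (@fst X Y).
Proof. by move=> [x y]; exact: cvg_fst. Qed.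

Lemma snd_continuous X Y : continuous (@snd X Y).
Proof. by move=> [x y]; exact: cvg_snd. Qed.

Lemma homotopic_refl X Y (f : X -> Y) : continuous f -> homotopic R f f.
Proof.
move=> cf; exists (f \o fst); split=> // x.
apply: continuous_comp; [exact: fst_continuous | exact: cf].
Qed.

Lemma eq_homotopic X Y (f g : X -> Y) : f =1 g -> continuous f ->
  homotopic R f g.
Proof. by move=> /funext <-; exact: homotopic_refl. Qed.

Lemma homotopic_of_real X Y (f g : X -> Y) (K : X -> R -> Y) :
  continuous (fun a : X * R => K a.1 a.2) ->
  (forall x, K x 0 = f x) -> (forall x, K x 1 = g x) -> homotopic R f g.
Proof.
move=> cK K0 K1; exists (fun a => K a.1 (val a.2)); split=> // a.
apply: (@continuous_comp _ _ _ (fun a : X * unit_interval R => (a.1, val a.2))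
  (fun a => K a.1 a.2)); last exact: cK.
apply: continuous_pair; first exact: fst_continuous.
apply: continuous_comp; first exact: snd_continuous.
exact: val_unit_interval_continuous.
Qed.

(** Precomposing with the retraction [clamp] makes time range over all of [R], where it can be
    shifted and scaled freely. *)
Lemma homotopic_to_real X Y (f g : X -> Y) : homotopic R f g ->
  exists K : X -> R -> Y,
  [/\ continuous (fun a : X * R => K a.1 a.2),
     forall x t, t <= 0 -> K x t = f x & forall x t, 1 <= t -> K x t = g x].
Proof.
move=> [H [cH H0 H1]]; exists (fun x t => H (x, clamp t)); split.
- move=> a.
  apply: (@continuous_comp _ _ _ (fun a : X * R => (a.1, clamp a.2)) H);
    last exact: cH.
  apply: continuous_pair; first exact: fst_continuous.
  apply: continuous_comp; first exact: snd_continuous.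
  exact: clamp_continuous.
- by move=> x t t0; rewrite clamp_le0.
- by move=> x t t1; rewrite clamp_ge1.
Qed.

Lemma homotopic_sym X Y (f g : X -> Y) : homotopic R f g -> homotopic R g f.
Proof.
move=> /homotopic_to_real[K [cK K0 K1]].
apply: (@homotopic_of_real _ _ _ _ (fun x t => K x (1 - t))).
- move=> a; apply: (@continuous_comp _ _ _ (fun a : X * R => (a.1, 1 - a.2))
    (fun a => K a.1 a.2)); last exact: cK.
  apply: continuous_pair; first exact: fst_continuous.
  apply: cvgB; first exact: cvg_cst.
  exact: snd_continuous.
- by move=> x; rewrite subr0 K1.
- by move=> x; rewrite subrr K0.
Qed.

Lemma homotopic_trans X Y (f g h : X -> Y) :
  homotopic R f g -> homotopic R g h -> homotopic R f h.
Proof.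
move=> /homotopic_to_real[K [cK K0 K1]] /homotopic_to_real[L [cL L0 L1]].
apply: (@homotopic_of_real _ _ _ _
  (fun x t => if t < 2^-1 then K x (2 * t) else L x (2 * t - 1))).
- have c2 : continuous (fun a : X * R => 2 * a.2).
    by move=> a; apply: cvgM; [exact: cvg_cst|exact: snd_continuous].
  have cK2 : continuous (fun a : X * R => K a.1 (2 * a.2)).
    move=> a; apply: (@continuous_comp _ _ _ (fun a : X * R => (a.1, 2 * a.2))
      (fun a => K a.1 a.2)); last exact: cK.
    by apply: continuous_pair; [exact: fst_continuous | exact: c2].
  have cL2 : continuous (fun a : X * R => L a.1 (2 * a.2 - 1)).
    move=> a; apply: (@continuous_comp _ _ _
      (fun a : X * R => (a.1, 2 * a.2 - 1))
      (fun a => L a.1 a.2)); last exact: cL.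
    apply: continuous_pair; first exact: fst_continuous.
    by apply: cvgB; [exact: c2 | exact: cvg_cst].
  move=> [x t]; have [tlt|tgt|teq] := ltgtP t 2^-1.
  + apply: near_eq_continuous_at (cK2 _) => /=.
    have := @snd_continuous X R (x, t) _ (lt_nbhsl tlt); rewrite nbhs_simpl /=.
    by apply: filterS => -[y u] /= ->.
  + apply: near_eq_continuous_at (cL2 _) => /=.
    have := @snd_continuous X R (x, t) _ (lt_nbhsr tgt); rewrite nbhs_simpl /=.
    by apply: filterS => -[y u] /= ult; rewrite ltNge (ltW ult).
  (* At time 1/2 the first homotopy has ended and the second one starts, so both branches equal
     [g x]. *)
  + apply: (@if_continuous_at _ _ (fun a : X * R => a.2 < 2^-1) _ _ _
      (cK2 _) (cL2 _)) => /=.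
    by rewrite teq divff ?pnatr_eq0// subrr K1// L0.
- by move=> x; rewrite invr_gt0 ltr0n mulr0 K0.
- move=> x; rewrite ltNge invf_le1 ?ler1n//= L1//.
  by rewrite mulr1 -addrA -[X in X <= _]addr0 lerD2l subr_ge0.
Qed.

Lemma homotopic_compl X Y Z (h : Y -> Z) (f g : X -> Y) : continuous h ->
  homotopic R f g -> homotopic R (h \o f) (h \o g).
Proof.
move=> ch [H [cH H0 H1]]; exists (h \o H); split.
- by move=> x; apply: continuous_comp; [exact: cH | exact: ch].
- by move=> x /=; rewrite H0.
- by move=> x /=; rewrite H1.
Qed.

Lemma homotopic_compr X Y Z (h : Z -> X) (f g : X -> Y) : continuous h ->
  homotopic R f g -> homotopic R (f \o h) (g \o h).
Proof.
move=> ch [H [cH H0 H1]]; exists (fun a => H (h a.1, a.2)); split.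
- move=> x; apply: (@continuous_comp _ _ _
    (fun a : Z * unit_interval R => (h a.1, a.2)) H); last exact: cH.
  apply: continuous_pair; last exact: snd_continuous.
  by apply: continuous_comp; [exact: fst_continuous | exact: ch].
- by move=> x /=; rewrite H0.
- by move=> x /=; rewrite H1.
Qed.

End homotopic_theory.

(** * Real representatives modulo 1 and circle-valued continuity *)

Section circle.
Variable R : realType.

(** The representative of [v] modulo 1 in [-1/2, 1/2). Centring at 0 moves the jump away from the
    integers, so that small increments of an angle lift continuously. *)
Definition crem (v : R) : R := v - (Num.floor (v + 2^-1))%:~R.

Lemma crem_itv v : - 2^-1 <= crem v < 2^-1.
Proof.
have := floor_itv (v + 2^-1); rewrite /crem intrD => /andP[h1 h2].
by apply/andP; split; lra.
Qed.

Lemma crem_subr_int v : crem v - v \is a Num.int.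
Proof. by rewrite /crem addrAC subrr sub0r rpredN intr_int. Qed.

Lemma crem_uniq v w : - 2^-1 <= w < 2^-1 -> w - v \is a Num.int -> crem v = w.
Proof.
move=> /andP[w1 w2] /intrP[k wvk].
have -> : v = w - k%:~R by rewrite -wvk; lra.
rewrite /crem (@floor_def _ _ (- k)) ?intrN; first by lra.
by rewrite intrD intrN; apply/andP; split; lra.
Qed.

Lemma crem0 : crem 0 = 0.
Proof. by apply: crem_uniq; rewrite ?subrr//; apply/andP; split; lra. Qed.

Lemma eq_crem v w : v - w \is a Num.int -> crem v = crem w.
Proof.
move=> vw; apply: crem_uniq (crem_itv w) _.
have -> : crem w - v = (crem w - w) - (v - w) by lra.
by rewrite rpredB// crem_subr_int.
Qed.

(** The hypothesis excludes exactly the jumps, at the half-integers; elsewhere the floor is locally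
    constant and [crem] is locally a translation. *)
Lemma crem_continuous v : - 2^-1 < crem v -> {for v, continuous crem}.
Proof.
move=> v1; pose k : R := (Num.floor (v + 2^-1))%:~R.
have /andP[_ v2] := crem_itv v.
apply: (@near_eq_continuous_at _ _ (fun w => w - k)); last first.
  by apply: cvgB; [exact: cvg_id | exact: cvg_cst].
have vk : crem v = v - k by [].
have l1 : k - 2^-1 < v by lra.
have l2 : v < k + 2^-1 by lra.
near=> w; apply/esym/crem_uniq; last first.
  by rewrite addrAC subrr sub0r rpredN intr_int.
have w1 : k - 2^-1 < w by near: w; exact: lt_nbhsr.
have w2 : w < k + 2^-1 by near: w; exact: lt_nbhsl.
by apply/andP; split; lra.
Unshelve. all: by end_near. Qed.

(* Continuity at [x] of [u] viewed as a map into [R / Z]. *)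
Definition circle_continuous_at (X : topologicalType) (u : X -> R) x :=
  exists2 g : X -> R, {for x, continuous g} &
    forall y, g y - u y \is a Num.int.

Lemma circle_continuousB (X : topologicalType) (u v : X -> R) x :
  circle_continuous_at u x -> circle_continuous_at v x ->
  circle_continuous_at (fun y => u y - v y) x.
Proof.
move=> [g cg gu] [h ch hv]; exists (fun y => g y - h y); first exact: cvgB.
move=> y; have -> : g y - h y - (u y - v y) = (g y - u y) - (h y - v y) by lra.
by rewrite rpredB.
Qed.

Lemma circle_continuous_comp (X Y : topologicalType) (f : X -> Y) (u : Y -> R)
    x : {for x, continuous f} -> circle_continuous_at u (f x) ->
  circle_continuous_at (u \o f) x.
Proof.
move=> cf [g cg gu]; exists (g \o f); first exact: continuous_comp.
by move=> y; exact: gu.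
Qed.

(** Since [crem] depends only on the class modulo 1, [u] can be replaced by the representative [g]
    that is continuous at [x]. *)
Lemma continuous_crem (X : topologicalType) (u : X -> R) x :
  circle_continuous_at u x -> - 2^-1 < crem (u x) ->
  {for x, continuous (crem \o u)}.
Proof.
move=> [g cg gu] ux.
have -> : crem \o u = crem \o g by apply/funext => y; apply/esym/eq_crem.
apply: continuous_comp cg _; apply: crem_continuous.
by rewrite (eq_crem (gu x)).
Qed.

End circle.

(** * Angle and base coordinates on the mapping torus *)

Section torus_coordinates.
Variables (R : realType) (P : topologicalType) (kappa : P -> P).
Hypothesis ckappa : continuous kappa.
Local Notation T := (mapping_torus R kappa).
Implicit Types z : T.

(** Normal form for the gluing. It is constant on classes, so the coordinates derived from it do not
    depend on the representative picked by [repr]. *)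
Definition torus_nf (a : P * unit_interval R) : P * R :=
  if val a.2 < 1 then (a.1, val a.2) else (kappa a.1, 0).

Definition torus_angle z : R := (torus_nf (repr z)).2.

Definition torus_base z : P := (torus_nf (repr z)).1.

Lemma torus_nf_compat a b : torus_pi kappa a = torus_pi kappa b ->
  torus_nf a = torus_nf b.
Proof.
move=> /eqquotP /asboolP.
elim=> [_ _ [x]|//|c d _ -> //|c d e _ -> _ -> //].
by rewrite /torus_nf /= ltxx ltr01.
Qed.

Lemma torus_nf_pi a : torus_nf (repr (torus_pi kappa a)) = torus_nf a.
Proof. by apply: torus_nf_compat; rewrite /torus_pi reprK. Qed.

Lemma torus_angle_pi a : torus_angle (torus_pi kappa a) = (torus_nf a).2.
Proof. by rewrite /torus_angle torus_nf_pi. Qed.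

Lemma torus_base_pi a : torus_base (torus_pi kappa a) = (torus_nf a).1.
Proof. by rewrite /torus_base torus_nf_pi. Qed.

Lemma torus_angle_j x : torus_angle (torus_j R kappa x) = 0.
Proof. by rewrite torus_angle_pi /torus_nf /= ltr01. Qed.

Lemma torus_base_j x : torus_base (torus_j R kappa x) = x.
Proof. by rewrite torus_base_pi /torus_nf /= ltr01. Qed.

Lemma torus_angle_itv z : 0 <= torus_angle z < 1.
Proof.
rewrite /torus_angle /torus_nf; case: ifP => /= [->|_];
  last by rewrite lexx ltr01.
by have /andP[-> _] := unit_interval_itv (repr z).2.
Qed.

(** The preimage of [A] is a neighbourhood of each of its points, hence open, and so [A] is open for
    the quotient topology. *)
Lemma nbhs_torus (A : set T) z :
  (forall a, A (torus_pi kappa a) -> nbhs a (torus_pi kappa @^-1` A)) ->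
  A z -> nbhs z A.
Proof.
by move=> oA Az; apply: open_nbhs_nbhs; split.
Qed.

Lemma near_time (Q : set R) (a : P * unit_interval R) :
  (\forall t \near val a.2, Q t) -> \forall b \near a, Q (val b.2).
Proof.
move=> hQ.
have cv : {for a, continuous (fun b : P * unit_interval R => val b.2)}.
  apply: continuous_comp; first exact: snd_continuous.
  exact: val_unit_interval_continuous.
exact: (cv _ hQ).
Qed.

Lemma torus_angle_continuous z : 0 < torus_angle z ->
  {for z, continuous torus_angle}.
Proof.
move=> z0; have /andP[_ z1] := torus_angle_itv z.
move=> U; rewrite nbhs_simpl /= => /nbhs_ballP[e /= e0 eU].
(* Positivity keeps [A] off the glued fibre, so its preimage only has to be examined at times
   strictly between 0 and 1. *)
pose A z' := 0 < torus_angle z' /\ `|torus_angle z - torus_angle z'| < e.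
have : nbhs z A; last first.
  move=> zA; apply: filterS zA => z' [_ z'e] /=; exact: eU.
apply: nbhs_torus; last by split=> //; rewrite subrr normr0.
move=> a; rewrite /A torus_angle_pi /torus_nf.
case: ifP => /= [a1 [a0 ae]|_ []]; last by rewrite ltxx.
have l1 := near_time (lt_nbhsl a1).
have l0 := near_time (lt_nbhsr a0).
have le : \forall b \near a, `|torus_angle z - val b.2| < e.
  apply: (@near_time (fun t => `|torus_angle z - t| < e)).
  have : open_nbhs (val a.2) (ball (torus_angle z) e).
    by split=> //; exact: ball_open.
  exact: open_nbhs_nbhs.
near=> b; rewrite /= torus_angle_pi /torus_nf.
have -> : val b.2 < 1 by near: b.
by split=> /=; near: b.
Unshelve. all: by end_near. Qed.

Lemma torus_wrapped_angle_continuous z : torus_angle z = 0 ->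
  {for z, continuous (@crem R \o torus_angle)}.
Proof.
move=> z0 U; rewrite nbhs_simpl /= z0 crem0 => /nbhs_ballP[e /= e0 eU].
pose d := Num.min e 2^-1.
(* A collar of the glued fibre, approached from both ends of the time interval. As [d <= 2^-1],
   [crem] leaves the angle unchanged on the first piece and subtracts 1 on the second. *)
pose A z' := torus_angle z' < d \/ 1 - d < torus_angle z'.
have d0 : 0 < d by rewrite lt_min e0 invr_gt0 ltr0n.
have de : d <= e by rewrite ge_min lexx.
have d2 : d <= 2^-1 by rewrite ge_min lexx orbT.
have zA : nbhs z A; last first.
  apply: filterS zA => z' Az'; apply: eU.
  have /andP[z'0 z'1] := torus_angle_itv z'.
  rewrite /ball /= sub0r normrN; case: Az' => z'd.
    rewrite (@crem_uniq _ _ (torus_angle z')) ?subrr//;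
      last by apply/andP; split; lra.
    by rewrite ger0_norm//; lra.
  rewrite (@crem_uniq _ _ (torus_angle z' - 1)).
  - by rewrite ltr0_norm; lra.
  - by apply/andP; split; lra.
  - by rewrite addrAC subrr sub0r rpredN rpred1.
apply: nbhs_torus; last by left; rewrite z0.
have wrap (a : P * unit_interval R) : 1 - d < val a.2 ->
    \forall b \near a, A (torus_pi kappa b).
  move=> a1; have := near_time (lt_nbhsr a1); apply: filterS => b b1.
  rewrite /A torus_angle_pi /torus_nf; case: ifP => _ /=; first by right.
  by left.
move=> a; rewrite /A torus_angle_pi /torus_nf.
case: ifP => /= [a1 [ad|]|/negbT].
- have := near_time (lt_nbhsl ad); apply: filterS => b bd.
  rewrite /= torus_angle_pi /torus_nf ifT; first by left.
  by apply: lt_le_trans bd _; lra.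
- exact: wrap.
- by rewrite -leNgt => a1 _; apply: wrap; apply: lt_le_trans a1; lra.
Qed.

(** The continuous representative is [crem] of the angle on the glued fibre, and the angle itself
    elsewhere. *)
Lemma torus_angle_circle_continuous z : circle_continuous_at torus_angle z.
Proof.
have /andP[z0 _] := torus_angle_itv z.
have [z_eq|z_gt] := eqVneq (torus_angle z) 0.
  exists (@crem R \o torus_angle); first exact: torus_wrapped_angle_continuous.
  by move=> y; exact: crem_subr_int.
exists torus_angle; first by apply: torus_angle_continuous; rewrite lt_def z_gt.
by move=> y; rewrite subrr rpred0.
Qed.

Lemma near_space (Q : set P) (a : P * unit_interval R) :
  (\forall x \near a.1, Q x) -> \forall b \near a, Q b.1.
Proof. by move=> hQ; exact: (fst_continuous hQ). Qed.

Lemma torus_base_continuous z : 0 < torus_angle z ->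
  {for z, continuous torus_base}.
Proof.
move=> z0 U; rewrite nbhs_simpl /= => zU.
pose A z' := 0 < torus_angle z' /\ (interior U) (torus_base z').
have zA : nbhs z A; last first.
  by apply: filterS zA => z' [_]; exact: interior_subset.
apply: nbhs_torus; last by [].
move=> a; rewrite /A torus_angle_pi torus_base_pi /torus_nf.
case: ifP => /= [a1 [a0 aU]|_ []]; last by rewrite ltxx.
have l1 := near_time (lt_nbhsl a1).
have l0 := near_time (lt_nbhsr a0).
have lU := @near_space (interior U) a (nbhs_interior aU).
near=> b; rewrite /= torus_angle_pi torus_base_pi /torus_nf.
have -> : val b.2 < 1 by near: b.
by split=> /=; near: b.
Unshelve. all: by end_near. Qed.

(* Unlike [torus_base], continuous across the glued fibre. *)
Definition torus_next_base z : P :=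
  if 2^-1 < torus_angle z then kappa (torus_base z) else torus_base z.

Lemma torus_next_base_continuous z : torus_angle z = 0 ->
  {for z, continuous torus_next_base}.
Proof.
move=> z0 U; rewrite nbhs_simpl /= => zU.
(* Angle 1/2 is removed because [torus_next_base] switches formula there; [interior U] makes the
   remaining condition open. *)
pose A z' := torus_angle z' != 2^-1 /\ (interior U) (torus_next_base z').
have zA : nbhs z A; last first.
  by apply: filterS zA => z' [_]; exact: interior_subset.
apply: nbhs_torus; last by split=> //; rewrite z0; apply/eqP; lra.
have next_lt (a : P * unit_interval R) : val a.2 < 2^-1 ->
    torus_next_base (torus_pi kappa a) = a.1.
  move=> a2; have a1 : val a.2 < 1 by lra.
  rewrite /torus_next_base torus_angle_pi torus_base_pi /torus_nf.
  by rewrite a1 ltNge (ltW a2).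
have next_gt (a : P * unit_interval R) : 2^-1 < val a.2 ->
    torus_next_base (torus_pi kappa a) = kappa a.1.
  move=> a2; rewrite /torus_next_base torus_angle_pi torus_base_pi /torus_nf.
  case: (ltP (val a.2) 1) => _ /=; first by rewrite ifT.
  by rewrite ltNge invr_ge0 ler0n.
move=> a [aN2]; have [a2|a2|a2] := ltgtP (val a.2) 2^-1.
- rewrite next_lt// => aU.
  have l2 := near_time (lt_nbhsl a2).
  have lU := @near_space (interior U) a (nbhs_interior aU).
  near=> b; have b2 : val b.2 < 2^-1 by near: b.
  split; last by rewrite next_lt//; near: b.
  rewrite torus_angle_pi /torus_nf ifT; last by lra.
  by rewrite lt_eqF.
- rewrite next_gt// => aU.
  have l2 := near_time (lt_nbhsr a2).
  have lU := @near_space (interior U \o kappa) a (ckappa (nbhs_interior aU)).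
  near=> b; have b2 : 2^-1 < val b.2 by near: b.
  split; last by rewrite next_gt//; near: b.
  rewrite torus_angle_pi /torus_nf; case: ifP => _; first by rewrite gt_eqF.
  by rewrite /=; apply/eqP; lra.
- by move: aN2; rewrite torus_angle_pi /torus_nf a2 ifT /= ?eqxx//; lra.
Unshelve. all: by end_near. Qed.

End torus_coordinates.

(** * Lifting a circle-valued homotopy to the real line *)

Lemma continuous_sum (R : realType) (X : topologicalType) n
    (g : 'I_n -> X -> R) x : (forall i, {for x, continuous (g i)}) ->
  {for x, continuous (fun y => \sum_(i < n) g i y)}.
Proof.
elim: n g => [|n IHn] g cg.
  have -> : (fun y => \sum_(i < 0) g i y) = fun=> 0.
    by apply/funext => y; rewrite big_ord0.
  exact: cvg_cst.
have -> : (fun y => \sum_(i < n.+1) g i y) =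
    (fun y => \sum_(i < n) g (widen_ord (leqnSn n) i) y + g ord_max y).
  by apply/funext => y; rewrite big_ord_recr.
by apply: cvgD; [exact: IHn | exact: cg].
Qed.

Section circle_lift.
Variables (R : realType) (P : topologicalType).

(** A Lebesgue number argument. The increment vanishes when [s = t], so it stays away from the jump
    of [crem] locally; compactness of the product of [P] with [0, 1] makes the step size uniform. *)
Lemma uniform_subdivision (u : P * R -> R) : compact [set: P] ->
  (forall a, circle_continuous_at u a) ->
  exists2 d : R, 0 < d &
    forall x t s, 0 <= t <= 1 -> `|t - s| < d ->
      - 2^-1 < crem (u (x, s) - u (x, t)).
Proof.
move=> compP cu.
pose Pr (d : R) (a : P * R) := forall s, `|a.2 - s| < d ->
  - 2^-1 < crem (u (a.1, s) - u a).
have cK : compact ([set: P] `*` [set` `[0 : R, 1]]).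
  by apply: compact_setX => //; exact: segment_compact.
have near_Pr : \forall d \near (0 : R)^'+,
    ([set: P] `*` [set` `[0 : R, 1]]) `<=` Pr d.
  (* The near-covering form of compactness, with [d] tending to 0 from the right, leaves only a
     local statement around each [(x0, t0)]. *)
  apply: (iffLR (compact_near_coveringP _) cK R (0 : R)^'+ Pr) => -[x0 t0] _.
  pose v (b : (P * R) * R) := u (b.1.1, b.2) - u b.1.
  have cv : circle_continuous_at v ((x0, t0), t0).
    apply: circle_continuousB; last first.
      apply: (@circle_continuous_comp _ _ _ fst u); last exact: cu.
      exact: fst_continuous.
    apply: (@circle_continuous_comp _ _ _
      (fun b : (P * R) * R => (b.1.1, b.2)) u); last exact: cu.
    apply: continuous_pair; last exact: snd_continuous.
    apply: (@continuous_comp _ _ _ fst fst); exact: fst_continuous.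
  have v0 : crem (v ((x0, t0), t0)) = 0 by rewrite /v /= subrr crem0.
  have half : - 2^-1 < crem (v ((x0, t0), t0)).
    by rewrite v0 oppr_lt0 invr_gt0 ltr0n.
  have := continuous_crem cv half (lt_nbhsr half).
  rewrite nbhs_simpl /= => -[[A B] /= [nA nB] AB].
  move: nB => /nbhs_ballP[e /= e0 eB].
  have e2 : 0 < e / 2 by lra.
  have nA' : \forall a \near (x0, t0), `|t0 - a.2| < e / 2.
    have : nbhs t0 (ball t0 (e / 2)) by exact: nbhsx_ballx.
    by move=> /(@snd_continuous P R (x0, t0)).
  (* Half of [e] is spent on moving from [t0] to [t] and half on moving from [t] to [s]. *)
  exists (A `&` [set a | `|t0 - a.2| < e / 2], [set d | d < e / 2]).
    split=> /=; first exact: filterI.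
    by apply: nbhs_right_lt.
  move=> [[x t] d] /= [[Axt t0t] de] s ts.
  apply: (AB ((x, t), s)); split=> //=; apply: eB; rewrite /ball /=.
  have -> : t0 - s = (t0 - t) + (t - s) by lra.
  apply: le_lt_trans (ler_normD _ _) _; move: t0t ts => /=; lra.
have [d [d0 Kd]] : exists d, 0 < d /\ [set: P] `*` [set` `[0 : R, 1]] `<=` Pr d.
  apply/(@filter_ex _ (0 : R)^'+); apply: filterI near_Pr.
  exact: nbhs_right_gt.
exists d => // x t s t01 ts; by apply: (Kd (x, t)).
Qed.

Lemma circle_lift (u : P * R -> R) : compact [set: P] ->
  (forall a, circle_continuous_at u a) ->
  (forall x t, t <= 0 -> u (x, t) = 0) ->
  (forall x t, 1 <= t -> u (x, t) = u (x, 1)) ->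
  exists (tau : P * R -> R) (M : nat),
  [/\ continuous tau, forall a, tau a - u a \is a Num.int,
      forall a, `|tau a| <= M%:R & forall x, tau (x, 0) = 0].
Proof.
move=> compP cu u0 u1.
have [d d0 hd] := uniform_subdivision compP cu.
(* [M] serves twice: the mesh [1 / M] is below [d], and [tau] will be a sum of [M] terms of absolute
   value at most 1/2. *)
pose M := (Num.truncn d^-1).+1.
have M0 : (0 : R) < M%:R by rewrite ltr0n.
have Md : (M%:R)^-1 < d.
  rewrite invf_plt ?posrE//.
  have := truncnS_gt d^-1; exact.
pose c (i : nat) : R := i%:R / M%:R.
have c0 : c 0 = 0 by rewrite /c mul0r.
have cM : c M = 1 by rewrite /c divff// gt_eqF.
have cS i : c i.+1 = c i + M%:R^-1 by rewrite /c -natr1 mulrDl mul1r.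
have ci0 i : 0 <= c i by rewrite /c divr_ge0.
have ci1 i : (i <= M)%N -> c i <= 1.
  by move=> iM; rewrite /c ler_pdivrMr// mul1r ler_nat.
(* The increments [w i.+1 a - w i a] telescope to [u a] and stay away from [1/2]
   modulo 1, where [crem] is discontinuous. *)
pose w i (a : P * R) := u (a.1, Num.min a.2 (c i)).
pose tau a := \sum_(i < M) crem (w i.+1 a - w i a).
have cw i a : circle_continuous_at (w i) a.
  apply: (@circle_continuous_comp _ _ _
    (fun b : P * R => (b.1, Num.min b.2 (c i))) u); last exact: cu.
  apply: continuous_pair; first exact: fst_continuous.
  have : {for a, continuous (fun b : P * R => Num.min b.2 (c i) : R^o)}.
    apply: (@continuous_min _ _ snd (fun=> c i)); first exact: snd_continuous.
    exact: cvg_cst.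
  by [].
have w_small i a : (i < M)%N -> - 2^-1 < crem (w i.+1 a - w i a).
  move=> iM; rewrite /w; have [ac|ac] := leP a.2 (c i).
    rewrite (min_idPl _) ?subrr ?crem0 ?oppr_lt0 ?invr_gt0//.
    by rewrite (le_trans ac)// cS lerDl invr_ge0 ltW.
  apply: hd; first by rewrite ci0 ci1// ltnW.
  have : c i <= Num.min a.2 (c i.+1).
    by rewrite le_min (ltW ac) cS lerDl invr_ge0 ltW.
  have : Num.min a.2 (c i.+1) <= c i.+1 by rewrite ge_min lexx orbT.
  rewrite cS => h1 h2; rewrite distrC ger0_norm; lra.
exists tau, M; split.
- rewrite /tau => a.
  apply: continuous_sum => i.
  apply: (@continuous_crem _ _ (fun b => w i.+1 b - w i b));
    last exact: w_small.
  by apply: circle_continuousB; exact: cw.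
(* Here the behaviour of [u] outside [0, 1] enters: [w 0] vanishes at all times, and stopping at
   time 1 does not change [u]. *)
- move=> a; have -> : u a = w M a - w 0%N a.
    rewrite /w cM c0 [X in _ - X]u0; last by rewrite ge_min lexx orbT.
    by rewrite subr0; case: a => x t /=; case: (leP t 1) => // /ltW /u1.
  have -> : w M a - w 0%N a = \sum_(i < M) (w i.+1 a - w i a).
    by rewrite -(big_mkord xpredT (fun i => w i.+1 a - w i a)) telescope_sumr.
  by rewrite -sumrB; apply: rpred_sum => i _; exact: crem_subr_int.
- move=> a; apply: le_trans (ler_norm_sum _ _ _) _.
  have -> : M%:R = \sum_(i < M) (1 : R) by rewrite sumr_const card_ord.
  apply: ler_sum => i _; have /andP[h1 h2] := crem_itv (w i.+1 a - w i a).
  by rewrite ler_norml; apply/andP; split; lra.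
- move=> x; rewrite /tau big1// => i _.
  by rewrite /w /= !(min_idPl (ci0 _)) subrr crem0.
Qed.

End circle_lift.

(** * From homotopies in the mapping torus to homotopies between iterates *)

Lemma absz_sub_pred (m : nat) (k : int) : k <= m%:Z ->
  absz (m%:Z - (k - 1))%R = (absz (m%:Z - k)%R).+1.
Proof. lia. Qed.

Lemma iter_continuous (X : topologicalType) (f : X -> X) n :
  continuous f -> continuous (iter n f).
Proof.
move=> cf; elim: n => [|n IHn] x; first exact: cvg_id.
by apply: continuous_comp; [exact: IHn | exact: cf].
Qed.

Lemma torus_j_continuous (R : realType) (P : topologicalType) (kappa : P -> P) :
  continuous (torus_j R kappa).
Proof.
move=> x.
apply: (@continuous_comp _ _ _ (fun y => (y, zeroI)) (torus_pi kappa)).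
  by apply: continuous_pair; [exact: cvg_id | exact: cvg_cst].
exact: pi_continuous.
Qed.

(** A level set of [g] is closed, and it is also open because a ball of radius 1 around an integer
    contains no other integer. *)
Lemma connected_int_constant (R : realType) (X : topologicalType) (g : X -> R) :
  connected [set: X] -> continuous g -> (forall x, g x \is a Num.int) ->
  forall x y, g x = g y.
Proof.
move=> conX cg gint x y.
suff E : [set z | g z = g y] = [set: X].
  by have : [set: X] x by []; rewrite -E.
have := conX [set z | g z = g y]; apply; first by exists y.
- exists (g @^-1` ball (g y) 1).
    by apply: open_comp; [move=> z _; exact: cg | exact: ball_open].
  rewrite setTI; apply/seteqP; split=> z /=; first by move=> ->; exact: ballxx.
  rewrite /ball /= => zy; apply/esym/eqP; rewrite -subr_eq0.
  apply: contraTT zy; rewrite -leNgt; apply: norm_intr_ge1.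
  by rewrite rpredB.
- exists (g @^-1` [set g y]); last by rewrite setTI.
  by apply: closed_comp; [move=> z _; exact: cg | exact: closed_eq].
Qed.

Section lift_homotopy.
Variables (R : realType) (P : topologicalType) (kappa f : P -> P).
Hypotheses (compP : compact [set: P]) (conP : connected [set: P]).
Hypotheses (ckappa : continuous kappa) (cf : continuous f).

Lemma homotopic_iter_of_torus :
  homotopic R (torus_j R kappa \o f) (torus_j R kappa) ->
  exists a b, homotopic R (iter a kappa \o f) (iter b kappa).
Proof.
move=> /homotopic_to_real[K [cK K0 K1]].
(* A point [x0] is needed to name the final value of [tau]; over an empty space all maps agree. *)
have [[x0 _]|P0] := pselect ([set: P] !=set0); last first.
  exists 0%N, 0%N; apply: eq_homotopic => //.
  by move=> x; case: P0; exists x.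
pose K' (a : P * R) := K a.1 a.2; pose u := @torus_angle R P kappa \o K'.
have [|x t t0|x t t1|tau [M [ctau tau_u tauM tau0]]] :=
  @circle_lift R P u compP.
- move=> a; apply: circle_continuous_comp; first exact: cK.
  exact: torus_angle_circle_continuous.
- by rewrite /u /= /K' /= K0// torus_angle_j.
- by rewrite /u /= /K' /= !K1.
(* The angle lies in [0, 1) and differs from [tau] by an integer, so it is the fractional part of
   [tau]. *)
have angleE a : torus_angle (K' a) = tau a - (Num.floor (tau a))%:~R.
  have /andP[h0 h1] := torus_angle_itv (K' a).
  have /intrP[k kE] := tau_u a; rewrite /u /= in kE.
  rewrite (@floor_def _ _ k); first lra.
  by rewrite intrD; apply/andP; split; lra.
(* The absolute value only casts the exponent to [nat]: [tau] is bounded by [M], so the difference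
   is nonnegative. *)
pose L x t :=
  iter `|M%:Z - Num.floor (tau (x, t))|%N kappa (torus_base (K x t)).
have tau1_int x : tau (x, 1) \is a Num.int.
  have := tau_u (x, 1); rewrite /u /= /K' /= K1// torus_angle_j subr0 //.
exists M, `|M%:Z - Num.floor (tau (x0, 1%R))|%N.
apply: (@homotopic_of_real _ _ _ _ _ L).
- move=> a.
  have cL n : 0 < torus_angle (K' a) ->
     {for a, continuous (iter n kappa \o (@torus_base R P kappa \o K'))}.
    move=> a0; apply: continuous_comp; last exact: iter_continuous.
    by apply: continuous_comp; [exact: cK | exact: torus_base_continuous].
  have cL' n : torus_angle (K' a) = 0 ->
     {for a, continuous (iter n kappa \o (@torus_next_base R P kappa \o K'))}.
    move=> a0; apply: continuous_comp; last exact: iter_continuous.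
    by apply: continuous_comp; [exact: cK | exact: torus_next_base_continuous].
  pose k := Num.floor (tau a).
  have /andP[angle0 angle1] := torus_angle_itv (K' a).
  have [a0|a0] := eqVneq (torus_angle (K' a)) 0.
    (* On the glued fibre [tau a] is the integer [k]. Within 1/2 of [k], the map [L] agrees with the
       fixed iterate of exponent [M - k] applied to [torus_next_base]. *)
    apply: near_eq_continuous_at (cL' `|M%:Z - k|%N a0).
    have tauE : tau a = k%:~R by have := angleE a; rewrite a0 -/k; lra.
    have kM : (k <= M%:Z)%R.
      by rewrite -(ler_int R) -tauE (le_trans (ler_norm _))// tauM.
    have l1 : k%:~R - 2^-1 < tau a by lra.
    have l2 : tau a < k%:~R + 2^-1 by lra.
    have n1 : \forall b \near a, k%:~R - 2^-1 < tau b := ctau _ _ (lt_nbhsr l1).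
    have n2 : \forall b \near a, tau b < k%:~R + 2^-1 := ctau _ _ (lt_nbhsl l2).
    near=> b; have b1 : k%:~R - 2^-1 < tau b by near: b.
    have b2 : tau b < k%:~R + 2^-1 by near: b.
    rewrite /L -surjective_pairing /= /torus_next_base angleE.
    rewrite -[K' b]/(K b.1 b.2).
    have [tk|kt] := ltP (tau b) k%:~R.
      rewrite (@floor_def _ _ (k - 1)); last first.
        by rewrite subrK tk intrD; apply/andP; split=> //; lra.
      rewrite ifT; last by rewrite intrD; lra.
      (* Just below [k] the floor is [k - 1], and the extra iterate this gives is the [kappa]
         contained in [torus_next_base]. *)
      rewrite -iterSr; congr (iter _ kappa _).
      exact/esym/absz_sub_pred.
    rewrite (@floor_def _ _ k); last by rewrite intrD kt /=; lra.
    by rewrite ifF//; apply/negbTE; rewrite -leNgt; lra.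
  (* Off the glued fibre [tau a] is not an integer, so its floor and hence the exponent are locally
     constant. *)
  apply: near_eq_continuous_at (cL `|M%:Z - k|%N _); last by rewrite lt_def a0.
  have angle_gt0 : 0 < torus_angle (K' a) by rewrite lt_def a0.
  have l1 : k%:~R < tau a by move: angle_gt0; rewrite angleE -/k; lra.
  have l2 : tau a < (k + 1)%:~R by move: angle1; rewrite angleE -/k intrD; lra.
  have n1 : \forall b \near a, k%:~R < tau b := ctau _ _ (lt_nbhsr l1).
  have n2 : \forall b \near a, tau b < (k + 1)%:~R := ctau _ _ (lt_nbhsl l2).
  near=> b; rewrite /L /=; congr (iter `|_ - _|%N _ _).
  rewrite -surjective_pairing; apply/esym/floor_def; apply/andP; split.
    by apply/ltW; near: b.
  by near: b.
- by move=> x; rewrite /L tau0 floor0 subr0 K0// torus_base_j.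
- move=> x; rewrite /L K1// torus_base_j; congr (iter `|_ - Num.floor _|%N _ _).
  apply: (@connected_int_constant _ _ (fun y => tau (y, 1))) => // y.
  apply: (@continuous_comp _ _ _ (fun y : P => (y, 1 : R)) tau);
    last exact: ctau.
  by apply: continuous_pair; [exact: cvg_id | exact: cvg_cst].
Unshelve. all: try by end_near.
Qed.

End lift_homotopy.

(** * Moving maps past iterates, and the shift equivalence *)

Section intertwine.
Variables (R : realType) (X Y : topologicalType).
Variables (f : X -> X) (g : Y -> Y) (h : X -> Y).

Lemma homotopic_iter_intertwine n :
  continuous f -> continuous g -> continuous h ->
  homotopic R (h \o f) (g \o h) ->
  homotopic R (h \o iter n f) (iter n g \o h).
Proof.
move=> cf cg ch hfg; elim: n => [|n IHn]; first exact: homotopic_refl.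
apply: (homotopic_trans (g := g \o h \o iter n f)).
  by apply: (homotopic_compr (h := iter n f)) hfg; exact: iter_continuous.
by apply: (homotopic_compl (h := g)) IHn.
Qed.

End intertwine.

Lemma homotopic_iter_add (R : realType) (X Y : topologicalType) (f : Y -> Y)
    (g : X -> Y) (h : X -> Y) m n p : continuous f ->
  homotopic R (iter m f \o g) (iter n f \o h) ->
  homotopic R (iter (p + m) f \o g) (iter (p + n) f \o h).
Proof.
move=> cf /(homotopic_compl (iter_continuous (n := p) cf)).
have iterE k (i : X -> Y) : iter p f \o (iter k f \o i) = iter (p + k) f \o i.
  by apply/funext => x; rewrite /= iterD.
by rewrite !iterE.
Qed.

(** Precomposition with [torus_j] turns the induced map into its time-zero end [torus_j \o f]. *)
Lemma homotopic_iter_of_torus_induced (R : realType) (P : topologicalType)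
    (kappa f : P -> P) (G : P * unit_interval R -> mapping_torus R kappa) :
  compact [set: P] -> connected [set: P] -> continuous kappa -> continuous f ->
  is_homotopy (torus_j R kappa \o f) (torus_j R kappa \o f \o kappa) G ->
  homotopic R (torus_induced G) id ->
  exists a b, homotopic R (iter a kappa \o f) (iter b kappa).
Proof.
move=> compP conP ckappa cf hG hGid; apply: homotopic_iter_of_torus => //.
have := homotopic_compr (@torus_j_continuous R P kappa) hGid.
congr (homotopic R _ _); apply/funext => x /=.
by rewrite (torus_inducedE hG); case: hG.
Qed.

Theorem theorem5p5 (R : realType) (P Q : topologicalType)
  (kappa : P -> P) (lambda : Q -> Q) (r : P -> Q) (s : Q -> P)
  (G : P * unit_interval R -> mapping_torus R kappa)
  (G' : Q * unit_interval R -> mapping_torus R lambda)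
  (compactP : compact [set: P]) (connectedP : connected [set: P])
  (compactQ : compact [set: Q]) (connectedQ : connected [set: Q])
  (ckappa : continuous kappa) (clambda : continuous lambda)
  (cr : continuous r) (cs : continuous s)
  (hr : homotopic R (r \o kappa) (lambda \o r))
  (hs : homotopic R (s \o lambda) (kappa \o s))
  (hG : is_homotopy (torus_j R kappa \o (s \o r))
                    (torus_j R kappa \o (s \o r) \o kappa) G)
  (hG' : is_homotopy (torus_j R lambda \o (r \o s))
                     (torus_j R lambda \o (r \o s) \o lambda) G')
  (hGid : homotopic R (torus_induced G) id)
  (hG'id : homotopic R (torus_induced G') id) :
  shift_equivalent R kappa lambda.
Proof.
have csr : continuous (s \o r).
  by move=> x; apply: continuous_comp; [exact: cr | exact: cs].
have crs : continuous (r \o s).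
  by move=> x; apply: continuous_comp; [exact: cs | exact: cr].
have [a1 [p1 hsr]] :=
  homotopic_iter_of_torus_induced compactP connectedP ckappa csr hG hGid.
have [a2 [q2 hrs]] :=
  homotopic_iter_of_torus_induced compactQ connectedQ clambda crs hG' hG'id.
(* Raising both relations to the common exponent [a] gives [kappa^a sr ~ kappa^p] and
   [lambda^a rs ~ lambda^q]. *)
have {}hsr := homotopic_iter_add (h := id) a2 ckappa hsr.
have {}hrs := homotopic_iter_add (h := id) a1 clambda hrs.
rewrite (addnC a2) in hsr; move: hsr hrs.
set a := (a1 + a2)%N; set p := (a2 + p1)%N; set q := (a1 + q2)%N => hsr hrs.
have ck n : continuous (iter n kappa) by exact: iter_continuous.
have cl n : continuous (iter n lambda) by exact: iter_continuous.
have hrn n := homotopic_iter_intertwine n ckappa clambda cr hr.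
have push n : homotopic R (r \o iter n kappa \o s) (iter n lambda \o (r \o s)).
  exact: homotopic_compr cs (hrn n).
(* The chain is [lambda^p rs ~ r kappa^p s ~ r kappa^a srs ~ lambda^a rsrs ~ lambda^q rs]. *)
have pq_rs :
    homotopic R (iter p lambda \o (r \o s)) (iter q lambda \o (r \o s)).
  have h1 := homotopic_compl cr (homotopic_compr cs hsr).
  apply: homotopic_trans (homotopic_sym (push p)) _.
  apply: homotopic_trans (homotopic_sym h1) _.
  apply: homotopic_trans (homotopic_compr crs (push a)) _.
  exact: (homotopic_compr crs hrs).
(* Applying [lambda^a] to [pq_rs] and then replacing [lambda^a rs] by [lambda^q] removes the factor
   [rs]. *)
have pq : homotopic R (iter (q + q) lambda) (iter (q + p) lambda).
  have h1 n :
      homotopic R (iter (a + n) lambda \o (r \o s)) (iter (n + q) lambda).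
    by rewrite addnC; exact: (homotopic_iter_add (h := id) n clambda hrs).
  apply: homotopic_trans (homotopic_sym (h1 q)) _.
  rewrite [(q + p)%N]addnC; apply: homotopic_trans (h1 p).
  exact/homotopic_sym/homotopic_iter_add.
(* The summand [a] lets both composites be simplified, to [kappa^(q + p)] and [lambda^(q + q)]; the
   summand [q] makes [pq] applicable to the latter. *)
exists r, (iter (q + a) kappa \o s), (q + p)%N; split; split=> //.
- by move=> y; apply: continuous_comp; [exact: cs | exact: ck].
- exact: homotopic_sym.
- have := homotopic_compl (ck (q + a)%N) hs.
  congr (homotopic R _ _); apply/funext => y /=.
  by rewrite -iterS iterSr.
- exact: (homotopic_iter_add (h := id) q ckappa hsr).
- apply: homotopic_trans (push _) _; apply: homotopic_trans pq.
  exact: (homotopic_iter_add (h := id) q clambda hrs).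
Qed.
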